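(* Let $M$ be a finite monoid, let $y\in M$ and let $N\le M$ be a submonoid. Let $\mathbf M$ be the pseudovariety of all finite monoids. Then $(\{y\},N)$ is an $\mathbf M$-stable pair of $M$ if and only if there is an $\mathscr L$-chain $Y$ of idempotents in $\mathrm{Stab}(y)$ such that $N\le\langle Y\rangle$, where $\langle Y\rangle$ denotes the submonoid generated by $Y$.
   Context: A relational morphism $\varphi:M\to N$ of monoids assigns to each $m\in M$ a non-empty subset $m\varphi\subseteq N$ such that $1\in 1\varphi$ and $(m\varphi)(m'\varphi)\subseteq (mm')\varphi$. For $n\in N$, $n\varphi^{-1}=\{m\in M: n\in m\varphi\}$, and for $S\subseteq N$, $S\varphi^{-1}=\bigcup_{n\in S}n\varphi^{-1}$. For a monoid $M$ and $m\in M$, $\mathrm{Stab}(m)=\{m'\in M: mm'=m\}$. For a pseudovariety of monoids $\mathbf V$ and a finite monoid $M$, a pair $(Y,U)$ with $Y\subseteq M$ a subset and $U\le M$ a submonoid is a $\mathbf V$-stable pair if, for all relational morphisms $\varphi:M\to N$ with $N\in\mathbf V$, there exists $n\in N$ such that $Y\subseteq n\varphi^{-1}$ and $U\le \mathrm{Stab}(n)\varphi^{-1}$. An $\mathscr L$-chain of idempotents is a set of idempotents any two of which are comparable in the $\mathscr L$-order, where $a\le_{\mathscr L} b$ means that $a$ is a left multiple of $b$; for idempotents $e,f$ one has $f\le_{\mathscr L}e$ iff $fe=f$. *)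

(* Defs.v *)
From HB Require Import structures.
From mathcomp Require Import all_boot.

Set Implicit Arguments.
Unset Strict Implicit.
Unset Printing Implicit Defensive.

Import Algebra.

#[short(type="finMonoidType")]
HB.structure Definition FinMonoid := {M of Monoid M & Finite M}.

HB.instance Definition _ (M N : finMonoidType) := Monoid.on (M * N)%type.

Local Open Scope group_scope.

Section Submonoids.
Variable M : finMonoidType.
Implicit Types (A Y U : {set M}) (a b e f m : M).

Definition submonoid A : bool :=
  (1 \in A) && ([set a * b | a in A, b in A] \subset A).

Definition generated_submonoid Y : {set M} :=
  \bigcap_(U : {set M} | submonoid U && (Y \subset U)) U.

Definition Stab m : {set M} := [set m' | m * m' == m].

Definition idempotent_elt e : bool := e * e == e.

Definition le_L a b : bool := [exists c, a == c * b].

Definition L_chain_of_idempotents Y : bool :=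
  [forall e in Y, idempotent_elt e] &&
  [forall e in Y, forall f in Y, le_L e f || le_L f e].

End Submonoids.

Section RelationalMorphisms.
Variables M N : finMonoidType.

Definition relational_morphism (phi : M -> {set N}) : Prop :=
  [/\ forall m, phi m != set0,
      1 \in phi 1
    & forall m m',
        [set a * b | a in phi m, b in phi m'] \subset phi (m * m')].

Definition rel_preim1 (phi : M -> {set N}) (n : N) : {set M} :=
  [set m | n \in phi m].

Definition rel_preim (phi : M -> {set N}) (S : {set N}) : {set M} :=
  \bigcup_(n in S) rel_preim1 phi n.

End RelationalMorphisms.

(* Closure under finite products is split into the empty product (one-element
   monoids) and binary products.  Closure under injective morphisms into a
   member accounts for both submonoids and isomorphic copies. *)
Record pseudovariety := Pseudovariety {
  pv_mem :> finMonoidType -> Prop;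
  pv_trivial : forall T : finMonoidType, #|T| = 1%N -> pv_mem T;
  pv_prod : forall S T : finMonoidType,
    pv_mem S -> pv_mem T -> pv_mem (S * T)%type;
  pv_sub : forall (S T : finMonoidType) (f : S -> T),
    monoid_morphism f -> injective f -> pv_mem T -> pv_mem S;
  pv_quo : forall (S T : finMonoidType) (f : S -> T),
    monoid_morphism f -> (forall t, exists s, f s = t) -> pv_mem S -> pv_mem T
}.

Definition all_finite_monoids : pseudovariety :=
  @Pseudovariety (fun _ => True) (fun _ _ => I) (fun _ _ _ _ => I)
    (fun _ _ _ _ _ _ => I) (fun _ _ _ _ _ _ => I).

Definition stable_pair (V : pseudovariety) (M : finMonoidType)
    (Y U : {set M}) : Prop :=
  submonoid U /\
  forall (N : finMonoidType) (phi : M -> {set N}),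
    V N -> relational_morphism phi ->
    exists n : N,
      Y \subset rel_preim1 phi n /\ U \subset rel_preim phi (Stab n).

(* Main.v *)
(* For sufficiency, an L-chain of idempotents lifts along any relational morphism
   to a chain of idempotents of the target; right multiplication by the lowest
   one moves a lift of [y] to an element stabilized by lifts of the whole chain.

   For necessity, [N] itself is shown to be an L-chain of idempotents.  Letting
   words over [M] act on a finite set [Q] of states gives a relational morphism
   from [M] to the monoid of self-maps of [Q].  Stability yields one word [x] such
   that each [t] in [N] is the value of a word [w] with [x w] and [x] acting in the
   same way.  Four automata, all reading from right to left, then suffice:
   - the one computing products gives [y * t = y];
   - the one recording the values of all suffixes puts the elements of [N] among
     the suffix values of [x], which form an L-chain;
   - the one cutting its input whenever the current factor is no longer J-above
     [t], and counting cuts modulo [#|M|.+1], gives [t ^+ k.+1 = t] with [0 < k];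
   - the one freezing just before its product stops being L-above [e = t ^+ k]
     ends in some [z] with [e] in [M * z] and [z * t = z], whence [t = e]. *)

From HB Require Import structures.
Require Import Defs.
From mathcomp Require Import all_boot.

Set Implicit Arguments.
Unset Strict Implicit.
Unset Printing Implicit Defensive.

Import Algebra.

Local Open Scope group_scope.

(** * Self-maps of a finite set under composition *)

Definition selfmap (Q : finType) := {ffun Q -> Q}.

HB.instance Definition _ (Q : finType) := Finite.on (selfmap Q).

Section SelfmapMonoid.
Variable Q : finType.
Implicit Types f g h : selfmap Q.

Definition selfmap_one : selfmap Q := [ffun q => q].
Definition selfmap_mul f g : selfmap Q := [ffun q => f (g q)].

Lemma selfmap_mulA : associative selfmap_mul.
Proof. by move=> f g h; apply/ffunP=> q; rewrite !ffunE. Qed.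

Lemma selfmap_mul1 : left_id selfmap_one selfmap_mul.
Proof. by move=> f; apply/ffunP=> q; rewrite !ffunE. Qed.

Lemma selfmap_mulr1 : right_id selfmap_one selfmap_mul.
Proof. by move=> f; apply/ffunP=> q; rewrite !ffunE. Qed.

HB.instance Definition _ :=
  isMonoid.Build (selfmap Q) selfmap_mulA selfmap_mul1 selfmap_mulr1.

End SelfmapMonoid.

(** * Pigeonhole, the L-order and powers in finite monoids *)

Lemma repeated_value (T : finType) (f : nat -> T) :
  exists i j, [/\ i < j, j <= #|T| & f i = f j].
Proof.
have /injectivePn[i [j neq_ij eq_ij]]: ~~ injectiveb (fun i : 'I_#|T|.+1 => f i).
  by apply/negP=> /injectiveP/leq_card; rewrite card_ord ltnn.
wlog lt_ij: i j neq_ij eq_ij / i < j => [hwlog|].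
  have := neq_ij; rewrite neq_ltn => /orP[lt_ij|lt_ji]; first exact: (hwlog i j).
  by apply: (hwlog j i); rewrite // eq_sym.
by exists i, j; split=> //; rewrite -ltnS.
Qed.

Section FiniteMonoid.
Variable M : finMonoidType.
Implicit Types (a b e m t y : M) (Y Z U : {set M}).

Lemma le_LP a b : reflect (exists c, a = c * b) (le_L a b).
Proof.
by apply: (iffP existsP) => -[c]; [move/eqP | move=> ->]; exists c.
Qed.

Lemma le_L_refl a : le_L a a.
Proof. by apply/le_LP; exists 1; rewrite mul1g. Qed.

Lemma le_L_mul a b : le_L (a * b) b.
Proof. by apply/le_LP; exists a. Qed.

Lemma le_L_trans a b c : le_L a b -> le_L b c -> le_L a c.
Proof.
by move=> /le_LP[u ->] /le_LP[v ->]; rewrite mulgA le_L_mul.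
Qed.

Lemma le_L_mul2r a b c : le_L a b -> le_L (a * c) (b * c).
Proof. by case/le_LP=> u ->; rewrite -mulgA le_L_mul. Qed.

Lemma le_L_idem a e : idempotent_elt e -> le_L a e -> a * e = a.
Proof. by move=> /eqP ee /le_LP[c ->]; rewrite -mulgA ee. Qed.

Lemma submonoidP U :
  reflect (1 \in U /\ {in U &, forall a b, a * b \in U}) (submonoid U).
Proof.
apply: (iffP andP) => -[U1 UU]; split=> //.
  by move=> a b Ua Ub; apply: (subsetP UU); apply: imset2_f.
by apply/subsetP=> _ /imset2P[a b Ua Ub ->]; apply: UU.
Qed.

Lemma sub_generated_submonoid Y : Y \subset generated_submonoid Y.
Proof. by apply/bigcapsP=> U /andP[]. Qed.

Lemma generated_submonoid_min Y U :
  submonoid U -> Y \subset U -> generated_submonoid Y \subset U.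
Proof. by move=> sU YU; apply: bigcap_inf; rewrite sU. Qed.

Lemma expg_eventually_periodic t :
  exists i k, 0 < k /\ t ^+ (i + k) = t ^+ i.
Proof.
have [i [j [lt_ij _ eq_ij]]] := repeated_value (natexp t).
by exists i, (j - i); rewrite subn_gt0 subnKC // ltnW.
Qed.

Lemma exists_idempotent_power t : exists n, idempotent_elt (t ^+ n.+1).
Proof.
have [i [k [k_gt0 tik]]] := expg_eventually_periodic t.
have tper q r : i <= r -> t ^+ (r + q * k) = t ^+ r.
  move=> le_ir; elim: q => [|q IHq]; first by rewrite addn0.
  rewrite -IHq mulSnr addnA -(subnKC (leq_trans le_ir (leq_addr (q * k) r))).
  by rewrite addnAC !expgnDr -expgnDr tik.
(* A multiple of the period [k] that is at least the index [i]; the successor on [i] keeps it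
   positive. *)
exists (i.+1 * k).-1; rewrite prednK ?muln_gt0 ?k_gt0 //.
by rewrite /idempotent_elt -expgnDr tper // (leq_trans (leqnSn i)) // leq_pmulr.
Qed.

Lemma L_chain_idempotent Y e :
  L_chain_of_idempotents Y -> e \in Y -> idempotent_elt e.
Proof. by case/andP=> /forall_inP idY _ /idY. Qed.

Lemma L_chain_total Y :
  L_chain_of_idempotents Y -> {in Y &, forall e f, le_L e f || le_L f e}.
Proof. by case/andP=> _ /forall_inP totY e f /totY/forall_inP; apply. Qed.

Lemma L_chain_sub Y Z :
  Z \subset Y -> L_chain_of_idempotents Y -> L_chain_of_idempotents Z.
Proof.
move=> /subsetP ZY chainY; apply/andP; split; apply/forall_inP=> e /ZY Ye.
  exact: L_chain_idempotent chainY Ye.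
by apply/forall_inP=> f /ZY; apply: L_chain_total.
Qed.

(** An element with the smallest principal left ideal works: anything below it in the chain
    generates the same ideal. *)
Lemma L_chain_min Y : L_chain_of_idempotents Y -> Y != set0 ->
  exists2 e, e \in Y & {in Y, forall f, le_L e f}.
Proof.
move=> chainY /set0Pn[e0 Ye0].
pose ideal b : {set M} := [set a | le_L a b].
have [e Ye min_e] := arg_minnP (fun b => #|ideal b|) Ye0.
exists e => // f Yf; have /orP[//|le_fe] := L_chain_total chainY Ye Yf.
have/eqP eq_fe: ideal f == ideal e.
  rewrite eqEcard min_e // andbT; apply/subsetP=> a; rewrite !inE => le_af.
  exact: le_L_trans le_af le_fe.
have: e \in ideal e by rewrite inE le_L_refl.
by rewrite -eq_fe inE.
Qed.

(** With [u = a * t], iterating [t = u * t * b] gives [t = u ^+ n * t * b ^+ n], so an idempotent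
    power of [u] fixes [t] on the left. *)
Lemma mem_two_sided_mul_square a b t :
  t = a * (t * t) * b -> exists c, t = c * (t * t).
Proof.
move=> def_t; pose u := a * t.
have utb : u * t * b = t by rewrite /u -[a * t * t]mulgA -def_t.
have tE n : t = u ^+ n * t * b ^+ n.
  elim: n => [|n IHn]; first by rewrite !expg0 mul1g mulg1.
  by rewrite expgSr expgS mulgA -[_ * u * t]mulgA -[_ * _ * b]mulgA utb.
have [n /eqP idu] := exists_idempotent_power u.
have ut : u ^+ n.+1 * t = t by rewrite [in LHS](tE n.+1) !mulgA idu -tE.
by exists (u ^+ n * a); rewrite -{1}ut expgSr /u !mulgA.
Qed.

(** Iteration gives [t = c ^+ n * t ^+ n.+1]; taking [n] to be the index of [t] removes the
    pre-periodic part. *)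
Lemma mem_mul_square_periodic c t :
  t = c * (t * t) -> exists2 k, 0 < k & t ^+ k.+1 = t.
Proof.
move=> def_t.
have tE n : t = c ^+ n * t ^+ n.+1.
  elim: n => [|n IHn]; first by rewrite expg0 mul1g expg1.
  by rewrite expgSr !expgS !mulgA -[_ * c * t * t]mulgA -[_ * c * _]mulgA
             -def_t -mulgA -expgS.
have [i [k [k_gt0 tik]]] := expg_eventually_periodic t; exists k => //.
by rewrite expgS {1}(tE i) -mulgA -expgnDr addSn expgSr tik -expgSr -tE.
Qed.

End FiniteMonoid.

(** * Relational morphisms defined by automata *)

Section Automaton.
Variables (M : finMonoidType) (Q : finType) (step : M -> Q -> Q).
Implicit Types (w : seq M) (m : M) (q : Q) (f : selfmap Q).

(* Words are read from right to left, so that [run] is a left action. *)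
Definition run w q := foldr step q w.

Lemma run_cat w1 w2 q : run (w1 ++ w2) q = run w1 (run w2 q).
Proof. exact: foldr_cat. Qed.

Definition prepend_letter (a : M) (p : M * selfmap Q) : M * selfmap Q :=
  (a * p.1, [ffun q => step a (p.2 q)]).

(** Reachability among the finitely many pairs of a value and a self-map makes membership decidable,
    although there are infinitely many words. *)
Definition word_maps m : {set selfmap Q} :=
  [set f | connect [rel p p' | [exists a, p' == prepend_letter a p]]
             (1, 1) (m, f)].

Lemma word_mapsP m f :
  reflect (exists2 w, \prod_(a <- w) a = m & f =1 run w) (f \in word_maps m).
Proof.
rewrite inE; apply: (iffP connectP) => [[s]|[w]].
  elim/last_ind: s m f => [|s p IHs] m f /=.
    by move=> _ [-> ->]; exists [::]; [rewrite big_nil | move=> q; rewrite ffunE].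
  rewrite rcons_path last_rcons => /andP[path_s /existsP[a /eqP def_p]] mf_p.
  move: def_p mf_p; case: (last _ s) IHs => m' f' IHs -> [-> ->].
  have [w wm wf] := IHs _ _ path_s erefl.
  exists (a :: w); first by rewrite big_cons wm.
  by move=> q; rewrite ffunE wf.
elim: w m f => [|a w IHw] m f.
  rewrite big_nil => <- fE; exists [::] => //=; congr (_, _).
  by apply/ffunP=> q; rewrite fE ffunE.
rewrite big_cons => <- fE.
have [|s path_s last_s] := IHw _ [ffun q => run w q] erefl.
  by move=> q; rewrite ffunE.
exists (rcons s (prepend_letter a (last (1, 1) s))).
  by rewrite rcons_path path_s /=; apply/existsP; exists a.
rewrite last_rcons -last_s /prepend_letter /=; congr (_, _).
by apply/ffunP=> q; rewrite !ffunE fE.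
Qed.

Lemma word_maps_relational : relational_morphism word_maps.
Proof.
split=> [m||m1 m2].
- apply/set0Pn; exists [ffun q => run [:: m] q]; apply/word_mapsP.
  by exists [:: m]; [rewrite big_seq1 | move=> q; rewrite ffunE].
- by apply/word_mapsP; exists [::]; [rewrite big_nil | move=> q; rewrite ffunE].
apply/subsetP=> _ /imset2P[f1 f2 /word_mapsP[w1 <- f1E] /word_mapsP[w2 <- f2E] ->].
apply/word_mapsP; exists (w1 ++ w2); first by rewrite big_cat.
by move=> q; rewrite ffunE run_cat f1E f2E.
Qed.

Lemma stable_pair_run (y : M) (N : {set M}) :
    stable_pair all_finite_monoids [set y] N ->
  exists2 x, \prod_(a <- x) a = y &
    forall t, t \in N ->
      exists2 w, \prod_(a <- w) a = t & forall q, run x (run w q) = run x q.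
Proof.
case=> _ /(_ _ _ I word_maps_relational)[n [yn Nn]].
have /word_mapsP[x xy nE]: n \in word_maps y.
  by move: yn; rewrite sub1set in_set.
exists x => // t /(subsetP Nn)/bigcupP[f].
rewrite in_set => /eqP nf; rewrite in_set => /word_mapsP[w wt fE].
by exists w => // q; rewrite -fE -!nE -[in RHS]nf ffunE.
Qed.

End Automaton.

(** * Elements of [N] stabilize [y] and are L-comparable *)

Section StablePair.
Variables (M : finMonoidType) (y : M) (N : {set M}).
Hypothesis stable_yN : stable_pair all_finite_monoids [set y] N.
Implicit Types (a b e m s t : M) (w x : seq M).

Lemma stable_sub_Stab : N \subset Stab y.
Proof.
have [x xy xN] := stable_pair_run (@mul M) stable_yN.
have runE w s : run (@mul M) w s = \prod_(a <- w) a * s.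
  by elim: w => [|a w /= ->]; rewrite ?big_nil ?mul1g // big_cons mulgA.
apply/subsetP=> t /xN[w wt /(_ 1)]; rewrite !runE xy wt !mulg1 inE.
by move=> ->.
Qed.

Definition suffix_step m (p : {set M} * M) := (m * p.2 |: p.1, m * p.2).

Lemma stable_le_L_total t u : t \in N -> u \in N -> le_L t u || le_L u t.
Proof.
have [x xy xN] := stable_pair_run suffix_step stable_yN.
have prodE w (A : {set M}) s : (run suffix_step w (A, s)).2 = \prod_(a <- w) a * s.
  by elim: w => [|a w /= ->]; rewrite ?big_nil ?mul1g // big_cons mulgA.
have sub_run w (A : {set M}) s : A \subset (run suffix_step w (A, s)).1.
  by elim: w => //= a w /subset_trans-> //; apply: subsetUr.
have mem_run w (A : {set M}) s : s \in A ->
    \prod_(a <- w) a * s \in (run suffix_step w (A, s)).1.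
  case: w => [|a w] As; first by rewrite big_nil mul1g.
  by rewrite big_cons -mulgA -(prodE w A) setU11.
(* Invariant: the recorded values form an L-chain, with the current product below all of them. *)
have chain_run w : let p := run suffix_step w ([set 1], 1) in
    {in p.1 &, forall a b, le_L a b || le_L b a} /\
    {in p.1, forall a, le_L p.2 a}.
  elim: w => [|c w [chain below]] /=.
    split=> [a b|a]; rewrite !inE; last by move/eqP->; apply: le_L_refl.
    by move=> /eqP-> /eqP->; rewrite le_L_refl.
  move: (run _ _ _) chain below => [A s] /= chain below.
  have cs_below a : a \in c * s |: A -> le_L (c * s) a.
    case/setU1P=> [->|Aa]; first exact: le_L_refl.
    exact: le_L_trans (le_L_mul c s) (below a Aa).
  split=> // a b /setU1P[-> /cs_below-> //|Aa /setU1P[->|Ab]]; last exact: chain.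
  by rewrite cs_below ?orbT // inE Aa orbT.
have mem_x v : v \in N -> v \in (run suffix_step x ([set 1], 1)).1.
  (* Reading [w] records [v], reading [x] afterwards only enlarges the set, and the final state is
     that of [x] alone. *)
  move=> /xN[w wv <-]; rewrite [run _ w _]surjective_pairing.
  apply: (subsetP (sub_run _ _ _)).
  by rewrite -wv -[X in X \in _]mulg1 mem_run // inE.
by move=> /mem_x xt /mem_x xu; apply: (chain_run x).1.
Qed.

End StablePair.

(** * Counting cuts: periodicity of the elements of [N] *)

Section CutCounting.
Variables (M : finMonoidType) (t : M).
Implicit Types (a b m s u : M) (w x : seq M).

Definition J_above s := [exists a, exists b, t == a * s * b].

Lemma J_aboveP s : reflect (exists a b, t = a * s * b) (J_above s).
Proof.
apply: (iffP existsP) => [[a /existsP[b /eqP ->]]|[a [b ->]]].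
  by exists a, b.
by exists a; apply/existsP; exists b.
Qed.

Lemma J_above1 : J_above 1.
Proof. by apply/J_aboveP; exists t, 1; rewrite !mulg1. Qed.

Lemma J_above_mulr s u : J_above (s * u) -> J_above s.
Proof.
case/J_aboveP=> a [b tE]; apply/J_aboveP; exists a, (u * b).
by rewrite [LHS]tE !mulgA.
Qed.

Lemma J_above_mull s u : J_above (s * u) -> J_above u.
Proof.
case/J_aboveP=> a [b tE]; apply/J_aboveP; exists (a * s), b.
by rewrite [LHS]tE !mulgA.
Qed.

(** The letter causing a cut is discarded, as it need not itself be J-above [t]; restarting at [1]
    keeps the product J-above [t]. *)
Definition cut_step m (p : M * nat) : M * nat :=
  if J_above (m * p.1) then (m * p.1, p.2) else (1, p.2.+1).

Definition cuts w s := foldr cut_step (s, 0) w.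

Lemma cuts_cat w1 w2 s :
  cuts (w1 ++ w2) s = ((cuts w1 (cuts w2 s).1).1,
                       (cuts w1 (cuts w2 s).1).2 + (cuts w2 s).2).
Proof.
rewrite /cuts foldr_cat -/(cuts w2 s); case: (cuts w2 s) => r c /=.
elim: w1 => [|m w1 IHw] //=; rewrite IHw /cut_step /=.
by case: ifP.
Qed.

Lemma J_above_cuts w s : J_above s -> J_above (cuts w s).1.
Proof.
move=> Js; elim: w => [|m w IHw] //=; rewrite /cut_step.
by case: ifP => // _; apply: J_above1.
Qed.

(* After a first cut the pending product is a factor of [\prod_(a <- w) a],
   which is J-above [t], so no second cut can occur inside [w]. *)
Lemma cuts_J_above w s : J_above (\prod_(a <- w) a) ->
  cuts w s = (\prod_(a <- w) a * s, 0) \/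
  (cuts w s).2 = 1%N /\ exists u, \prod_(a <- w) a = (cuts w s).1 * u.
Proof.
elim: w => [|m w IHw]; first by rewrite big_nil mul1g; left.
rewrite big_cons => Jmw.
case: (IHw (J_above_mull Jmw)) => [cutsE|[c1 [u wu]]]; rewrite /= /cut_step.
  rewrite cutsE /= mulgA; case: ifP => _; [by left | right; split=> //].
  by exists (m * \prod_(a <- w) a); rewrite mul1g.
rewrite wu mulgA in Jmw; rewrite (J_above_mulr Jmw); right; split=> //.
by exists u; rewrite wu mulgA.
Qed.

Definition wpower w n := flatten (nseq n w).

Lemma cuts_wpower w n s : \prod_(a <- w) a = t ->
  (cuts (wpower w n) s).2 <= n /\
  ((cuts (wpower w n) s).2 = 0 -> (cuts (wpower w n) s).1 = t ^+ n * s).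
Proof.
move=> wt; have Jw : J_above (\prod_(a <- w) a).
  by rewrite wt; apply/J_aboveP; exists 1, 1; rewrite mul1g mulg1.
elim: n => [|n [le_n IHn]]; first by rewrite expg0 mul1g.
rewrite /wpower /= -/(wpower w n) cuts_cat /=.
set r := cuts (wpower w n) s in le_n IHn *.
case: (cuts_J_above r.1 Jw) => [->|[-> _]] //=; rewrite add0n; split=> [|r0].
  exact: leqW.
by rewrite IHn // wt expgS mulgA.
Qed.

Definition mod_cut_step m (p : M * 'I_#|M|.+1) : M * 'I_#|M|.+1 :=
  if J_above (m * p.1) then (m * p.1, p.2) else (1, ordS p.2).

Lemma run_mod_cut w s c :
  (run mod_cut_step w (s, c)).1 = (cuts w s).1 /\
  (run mod_cut_step w (s, c)).2 = (c + (cuts w s).2) %% #|M|.+1 :> nat.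
Proof.
elim: w => [|m w [IH1 IH2]] /=; first by rewrite addn0 modn_small.
rewrite /mod_cut_step /cut_step IH1; case: ifP => _ //=; split=> //.
by rewrite IH2 -addn1 modnDml addn1 addnS.
Qed.

Variables (y : M) (N : {set M}).
Hypothesis stable_yN : stable_pair all_finite_monoids [set y] N.

(* If [t] were strictly J-above [t ^+ 2], every power [t ^+ k] read from a
   repeating state with [k <= #|M|] would make between [1] and [#|M|] cuts,
   which a counter modulo [#|M|.+1] detects. *)
Lemma stable_periodic : t \in N -> exists2 k, 0 < k & t ^+ k.+1 = t.
Proof.
have [x xy xN] := stable_pair_run mod_cut_step stable_yN.
case/xN=> w wt runw; set step := mod_cut_step in runw.
have runpow n q : run step x (run step (wpower w n) q) = run step x q.
  by elim: n => // n IHn; rewrite /wpower /= run_cat runw.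
have wpowerD i j q :
    run step (wpower w (i + j)) q = run step (wpower w i) (run step (wpower w j) q).
  by rewrite /wpower nseqD flatten_cat run_cat.
pose q i := run step (wpower w i) (1, ord0).
(* Among the states reached from [1] by copies of [w], some product recurs after at most [#|M|]
   further copies. *)
have [i [j [lt_ij le_jM eq_ij]]] := repeated_value (fun i => (q i).1).
have Jq : J_above (q i).1.
  by rewrite /q (run_mod_cut _ _ _).1; apply/J_above_cuts/J_above1.
pose k := j - i; have k_gt0 : 0 < k by rewrite subn_gt0.
have le_kM : k < #|M|.+1 by rewrite ltnS (leq_trans (leq_subr i j)).
have qj : q j = run step (wpower w k) (q i) by rewrite -wpowerD subnK // ltnW.
move: (runpow k (q i)) eq_ij; rewrite -qj.
case: (q i) (q j) Jq qj => [s c] [s' d] /= Js qj runx ss'.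
rewrite -{s'}ss' in qj runx.
have := run_mod_cut (wpower w k) s c; rewrite -/step -qj /= => -[s_k d_k].
(* Both runs of [x] start from the product [s], so they add the same number of cuts; equal final
   counters then force the loop to make none. *)
have := run_mod_cut x s d; have := run_mod_cut x s c.
rewrite -/step runx => -[_ ->] [_ /eqP].
rewrite d_k modnDml eqn_modDr -{1}[nat_of_ord c]addn0 eqn_modDl mod0n eq_sym.
have [le_k cut0] := cuts_wpower k s wt.
rewrite modn_small; last exact: leq_ltn_trans le_k le_kM.
move=> /eqP/cut0; rewrite -s_k => ts.
(* Using [s = t ^+ k * s] twice in [t = a * s * b] exhibits [t * t] as a factor of [t], even for
   [k = 1]. *)
have [a [b def_t]] := J_aboveP _ Js.
have [c' tc'] : exists c', t = c' * (t * t).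
  apply: (@mem_two_sided_mul_square _ (a * t ^+ k.-1) (t ^+ k.-1 * s * b)).
  rewrite {1}def_t {1}ts {1}ts -(prednK k_gt0) {1}expgSr expgS /=.
  by rewrite !mulgA.
exact: mem_mul_square_periodic tc'.
Qed.

End CutCounting.

(** * Freezing: idempotency of the elements of [N] *)

Section Freezing.
Variables (M : finMonoidType) (e : M).
Implicit Types (m s t : M) (w : seq M).

Definition freeze_step m (p : M * bool) : M * bool :=
  if p.2 && le_L e (m * p.1) then (m * p.1, true) else (p.1, false).

Lemma run_freeze_live w s : le_L e (\prod_(a <- w) a * s) ->
  run freeze_step w (s, true) = (\prod_(a <- w) a * s, true).
Proof.
elim: w => [|m w IHw]; first by rewrite big_nil mul1g.
rewrite big_cons -mulgA => le_e /=.
by rewrite IHw ?(le_L_trans le_e) ?le_L_mul // /freeze_step /= le_e.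
Qed.

Lemma run_freeze_le_L w s b : le_L e s -> le_L e (run freeze_step w (s, b)).1.
Proof.
move=> le_es; elim: w => //= m w IHw; rewrite /freeze_step.
by case: ifP => // /andP[].
Qed.

(** On elements [r = r * e], right multiplication by [t] is undone by [t'] and preserves being
    L-above [e], so both runs stay live or freeze together. *)
Lemma run_freeze_mulr t t' w s b :
    t * t' = e -> t' * t = e -> e * t = t -> t * e = t -> s * e = s ->
  let p := run freeze_step w (s, b) in
  p.1 * e = p.1 /\ run freeze_step w (s * t, b) = (p.1 * t, p.2).
Proof.
move=> tt' t't et te se /=.
have le_mulr r : r * e = r -> le_L e (r * t) = le_L e r.
  move=> re; apply/idP/idP=> [le_rt|le_r].
    apply: (@le_L_trans _ _ (e * t')).
      by apply/le_LP; exists t; rewrite mulgA te tt'.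
    have rE : r * t * t' = r by rewrite -mulgA tt'.
    by rewrite -[X in le_L _ X]rE; apply: le_L_mul2r.
  apply: (@le_L_trans _ _ (e * t)); last exact: le_L_mul2r.
  by apply/le_LP; exists t'; rewrite et t't.
elim: w => [|m w [IHe IHw]] //=; rewrite IHw; move: IHe.
case: (run _ w (s, b)) => r c /= re; rewrite /freeze_step /= mulgA le_mulr.
  by case: ifP => _ //=; rewrite -mulgA re.
by rewrite -mulgA re.
Qed.

End Freezing.

Lemma stable_idempotent (M : finMonoidType) (y : M) (N : {set M}) (t : M) :
  stable_pair all_finite_monoids [set y] N -> t \in N -> idempotent_elt t.
Proof.
move=> stable_yN Nt; have [k k_gt0 tk] := stable_periodic stable_yN Nt.
(* [t'] inverts [t] relative to the idempotent [e]; for [k = 1] it is just [1]. *)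
pose e := t ^+ k; pose t' := t ^+ k.-1.
have tt' : t * t' = e by rewrite -expgS prednK.
have t't : t' * t = e by rewrite -expgSr prednK.
have et : e * t = t by rewrite -expgSr.
have te : t * e = t by rewrite -expgS.
have ee : e * e = e by rewrite -{1}t't -mulgA te.
have [x xy xN] := stable_pair_run (freeze_step e) stable_yN.
have [w wt runw] := xN t Nt.
have le_et : le_L e t by rewrite -t't le_L_mul.
have le_ett : le_L e (t * t).
  by apply/le_LP; exists (t' * t'); rewrite mulgA -[t' * t' * t]mulgA t't -mulgA et t't.
(* From [t], the word [w] leads to [t * t] without freezing; so [x] ends alike from [t * t] and from
   [t], although the first product is the second times [t]. *)
have := runw (t, true); rewrite run_freeze_live wt //.
have [_ ->] := run_freeze_mulr x true tt' t't et te te.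
have /le_LP[c] := run_freeze_le_L x true le_et.
case: (run _ x _) => z b /= ez [zt].
have et_e : e * t = e by rewrite ez -mulgA zt.
by rewrite /idempotent_elt -[t]et et_e ee.
Qed.

(** * Lifting L-chains along relational morphisms *)

Section ChainLifting.
Variables (M K : finMonoidType) (phi : M -> {set K}).
Hypothesis phi_rel : relational_morphism phi.
Implicit Types (e f m : M) (k : K) (Y : {set M}).

Lemma relational_mul m m' k k' :
  k \in phi m -> k' \in phi m' -> k * k' \in phi (m * m').
Proof.
by case: phi_rel => _ _ phiM km km'; apply: (subsetP (phiM m m')); apply: imset2_f.
Qed.

Lemma relational_idempotent_power e k n :
  idempotent_elt e -> k \in phi e -> k ^+ n.+1 \in phi e.
Proof.
move=> /eqP ee ke; elim: n => [|n IHn]; first by rewrite expg1.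
by rewrite expgS -ee relational_mul.
Qed.

(** Induction removing the lowest [f] of [Y]: if [k0] lifts [f] and [g] lifts [e], then [g * k0]
    lifts [e * f = e], and its idempotent power ends in [k0], so it absorbs what [k0] absorbs.
    Idempotency of [k0] lets it serve as the lift of [f]. *)
Lemma lift_L_chain Y e :
    L_chain_of_idempotents Y -> idempotent_elt e -> {in Y, forall f, le_L e f} ->
  exists k, [/\ k \in phi e, idempotent_elt k &
    {in Y, forall f, exists2 k', k' \in phi f & k * k' = k}].
Proof.
have [n] := ubnP #|Y|; elim: n => // n IHn in Y e *.
rewrite ltnS => le_Yn chainY ide le_eY.
have [Y0|Y_neq0] := eqVneq Y set0.
  have [phi_neq0 _ _] := phi_rel; have /set0Pn[g ge] := phi_neq0 e.
  have [p idg] := exists_idempotent_power g; exists (g ^+ p.+1).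
  by split=> // [|f]; [apply: relational_idempotent_power | rewrite Y0 inE].
have [f Yf le_fY] := L_chain_min chainY Y_neq0.
have [||||k0 [k0f /eqP idk0 liftY]] := IHn (Y :\ f) f.
- by rewrite (cardsD1 f) Yf in le_Yn.
- exact: L_chain_sub (subsetDl _ _) chainY.
- exact: L_chain_idempotent chainY Yf.
- by move=> g /setD1P[_ /le_fY].
have [phi_neq0 _ _] := phi_rel; have /set0Pn[g ge] := phi_neq0 e.
have gk0e : g * k0 \in phi e.
  rewrite -(le_L_idem (L_chain_idempotent chainY Yf) (le_eY f Yf)).
  exact: relational_mul.
have [p idk] := exists_idempotent_power (g * k0).
exists ((g * k0) ^+ p.+1); split=> //; first exact: relational_idempotent_power.
move=> h Yh; rewrite expgSr mulgA; have [->|neq_hf] := eqVneq h f.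
  by exists k0; rewrite // -[LHS]mulgA idk0.
have [|k' k'h k0k'] := liftY h; first by rewrite !inE neq_hf.
by exists k'; rewrite // -[LHS]mulgA k0k'.
Qed.

End ChainLifting.

(** * The two implications *)

Lemma L_chain_stable (M : finMonoidType) (y : M) (N Y : {set M}) :
    submonoid N -> L_chain_of_idempotents Y -> Y \subset Stab y ->
    N \subset generated_submonoid Y ->
  stable_pair all_finite_monoids [set y] N.
Proof.
move=> subN chainY YS NY; split=> // K phi _ phi_rel.
suff [n ny liftY] : exists2 n, n \in phi y &
    {in Y, forall f, exists2 k, k \in phi f & n * k = n}.
  exists n; split; first by rewrite sub1set inE.
  (* The elements related to [Stab n] form a submonoid, so lifting the generators is enough. *)
  apply: subset_trans NY (generated_submonoid_min _ _); last first.
    apply/subsetP=> f /liftY[k kf nk]; apply/bigcupP; exists k; rewrite inE ?nk //.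
  apply/submonoidP; split=> [|a b].
    case: phi_rel => _ phi1 _; apply/bigcupP; exists 1; rewrite inE ?mulg1 //.
  move=> /bigcupP[k]; rewrite in_set => /eqP nk; rewrite in_set => ka.
  move=> /bigcupP[l]; rewrite in_set => /eqP nl; rewrite in_set => lb.
  apply/bigcupP; exists (k * l); rewrite in_set; last exact: relational_mul.
  by rewrite mulgA nk nl.
have [phi_neq0 _ _] := phi_rel; have /set0Pn[n ny] := phi_neq0 y.
have [Y0|Y_neq0] := eqVneq Y set0.
  by exists n => // f; rewrite Y0 inE.
have [e Ye le_eY] := L_chain_min chainY Y_neq0.
have [k [ke _ liftY]] :=
  lift_L_chain phi_rel chainY (L_chain_idempotent chainY Ye) le_eY.
exists (n * k).
  have /eqP <- : y * e == y by have := subsetP YS e Ye; rewrite inE.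
  exact: relational_mul.
by move=> f /liftY[k' k'f kk']; exists k' => //; rewrite -mulgA kk'.
Qed.

Theorem theorem5p2 (M : finMonoidType) (y : M) (N : {set M})
    (hN : submonoid N) :
  stable_pair all_finite_monoids [set y] N <->
  exists Y : {set M},
    [/\ L_chain_of_idempotents Y, Y \subset Stab y
      & N \subset generated_submonoid Y].
Proof.
split=> [stable_yN|[Y [chainY YS NY]]]; last exact: L_chain_stable YS NY.
exists N; split; [|exact: stable_sub_Stab|exact: sub_generated_submonoid].
apply/andP; split; apply/forall_inP=> t Nt.
  exact: stable_idempotent stable_yN Nt.
by apply/forall_inP=> u Nu; apply: (stable_le_L_total stable_yN).
Qed.
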